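(* Let $\mathcal{T}=(t_{ijkl})$ be a real $4$th-order $3$-dimensional symmetric tensor such that, for all pairwise distinct $i,j,k\in\{1,2,3\}$, $t_{iiii}=1$, $t_{iiij}=1$, $t_{iijj}=-1$ and $t_{iijk}\in\{-1,0,1\}$. Then $\mathcal{T}$ is strictly copositive if and only if $t_{1123}+t_{1223}+t_{1233}\ge 0$.
   Context: A real $4$th-order $3$-dimensional tensor $\mathcal{T}=(t_{ijkl})$, $1\le i,j,k,l\le 3$, is symmetric if its entries are invariant under all permutations of the indices. For $x\in\mathbb{R}^3$, $\mathcal{T}x^4=\sum_{i,j,k,l=1}^3 t_{ijkl}x_ix_jx_kx_l$. $\mathcal{T}$ is strictly copositive if $\mathcal{T}x^4>0$ for every nonzero $x\in\mathbb{R}^3$ with all coordinates nonnegative. *)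

(* Defs.v *)
From HB Require Import structures.
From mathcomp Require Import all_boot all_order all_fingroup all_algebra.
From mathcomp Require Import reals.

Set Implicit Arguments.
Unset Strict Implicit.
Unset Printing Implicit Defensive.

Import Order.TTheory GRing.Theory Num.Theory.
Local Open Scope ring_scope.

(* Indices range over 'I_n, i.e., from 0 to n - 1 instead of from 1 to n. *)
Definition tensor4 (R : Type) (n : nat) : Type :=
  'I_n -> 'I_n -> 'I_n -> 'I_n -> R.

Definition symmetric_tensor4 (R : Type) (n : nat) (T : tensor4 R n) : Prop :=
  forall (s : 'S_4) (i : 'I_4 -> 'I_n),
    T (i (s 0)) (i (s 1)) (i (s 2)) (i (s 3)) = T (i 0) (i 1) (i 2) (i 3).

Definition tensor4_form (R : pzRingType) (n : nat) (T : tensor4 R n)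
    (x : 'rV[R]_n) : R :=
  \sum_i \sum_j \sum_k \sum_l T i j k l * x 0 i * x 0 j * x 0 k * x 0 l.

Definition strictly_copositive4 (R : numDomainType) (n : nat)
    (T : tensor4 R n) : Prop :=
  forall x : 'rV[R]_n,
    x != 0 -> (forall i, 0 <= x 0 i) -> 0 < tensor4_form T x.

(* Main.v *)
(** For the entries of the theorem [T x^4] is the ternary quartic [quartic a b c]
    below, with [a, b, c] the three entries [t_{iijk}].  At [(1, 1, 1)] it equals
    [9 + 12 (a + b + c)], and [a + b + c] is an integer.  Conversely, sorting the
    coordinates as [m <= m + p <= m + p + q], Abel summation gives
    [a m + b (m + p) + c (m + p + q) >= - (p + q)] as soon as [a + b + c >= 0],
    [a <= 1] and [c >= -1], and the quartic with this worst value has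
    nonnegative coefficients in [m, p, q]. *)
Require Import Defs.
From HB Require Import structures.
From mathcomp Require Import all_boot all_order all_fingroup all_algebra.
From mathcomp Require Import reals.
From mathcomp Require Import ring lra.

Set Implicit Arguments.
Unset Strict Implicit.
Unset Printing Implicit Defensive.

Import Order.TTheory GRing.Theory Num.Theory.
Local Open Scope ring_scope.

(** The factors 4, 6 and 12 count the arrangements of the index patterns [iiij], [iijj] and [iijk];
    the sign of 6 comes from [t_{iijj} = -1]. *)
Definition quartic (R : pzRingType) (a b c x y z : R) : R :=
  x ^+ 4 + y ^+ 4 + z ^+ 4
  + 4 * (x ^+ 3 * y + x * y ^+ 3 + x ^+ 3 * z + x * z ^+ 3
         + y ^+ 3 * z + y * z ^+ 3)
  - 6 * (x ^+ 2 * y ^+ 2 + x ^+ 2 * z ^+ 2 + y ^+ 2 * z ^+ 2)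
  + 12 * (x * y * z) * (a * x + b * y + c * z).

Section Quartic.
Variable R : realFieldType.
Implicit Types a b c x y z m p q : R.

Lemma quarticC12 a b c x y z : quartic a b c x y z = quartic b a c y x z.
Proof. by rewrite /quartic; ring. Qed.

Lemma quarticC23 a b c x y z : quartic a b c x y z = quartic a c b x z y.
Proof. by rewrite /quartic; ring. Qed.

Lemma quartic_sorted_gt0 a b c m p q :
  0 <= a + b + c -> a <= 1 -> -1 <= c ->
  0 <= m -> 0 <= p -> 0 <= q -> 0 < m + p + q ->
  0 < quartic a b c m (m + p) (m + p + q).
Proof.
move=> s_ge0 a_le1 c_geN1 m_ge0 p_ge0 q_ge0 mpq_gt0.
(* The last factor is the excess of the Abel sum over its worst value [- (p + q)]. The pure fourth
   powers stand apart because they alone give strictness. *)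
have -> : quartic a b c m (m + p) (m + p + q) =
    (9 * m ^+ 4 + 4 * p ^+ 4 + q ^+ 4)
  + (12 * m ^+ 3 * p + 12 * m ^+ 2 * p ^+ 2 + 6 * m ^+ 2 * q ^+ 2
     + 12 * m * p ^+ 3 + 12 * m * p ^+ 2 * q + 24 * m * p * q ^+ 2
     + 12 * m * q ^+ 3 + 8 * p ^+ 3 * q + 12 * p ^+ 2 * q ^+ 2
     + 8 * p * q ^+ 3)
  + 12 * (m * (m + p) * (m + p + q))
    * (m * (a + b + c) + p * (b + c + 1) + q * (c + 1)).
  by rewrite /quartic; ring.
have bc_ge0 : 0 <= b + c + 1 by lra.
have c_ge0 : 0 <= c + 1 by lra.
(* Dropping the two nonnegative groups leaves [9 m^4 + 4 p^4 + q^4], and one of [m], [p], [q] is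
   positive. *)
apply: ltr_wpDr; first by do ![done | apply: mulr_ge0 | apply: addr_ge0].
apply: ltr_wpDr; first by do ![apply: addr_ge0 | apply: mulr_ge0 | apply: exprn_ge0].
have [m_gt0|m_le0] := ltP 0 m.
  by rewrite !ltr_wpDr ?(mulr_ge0, exprn_ge0) // mulr_gt0 ?exprn_gt0.
have [p_gt0|p_le0] := ltP 0 p.
  rewrite ltr_wpDr ?exprn_ge0 // ltr_wpDl ?(mulr_ge0, exprn_ge0) //.
  by rewrite mulr_gt0 ?exprn_gt0.
by rewrite ltr_wpDl ?(addr_ge0, mulr_ge0, exprn_ge0) // exprn_gt0 //; lra.
Qed.

(** Two-sided bounds on all three parameters, since sorting can pair any of them with the smallest
    or the largest coordinate. *)
Lemma quartic_gt0 a b c x y z :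
  0 <= a + b + c -> -1 <= a <= 1 -> -1 <= b <= 1 -> -1 <= c <= 1 ->
  0 <= x -> 0 <= y -> 0 <= z -> 0 < x + y + z ->
  0 < quartic a b c x y z.
Proof.
have sorted a' b' c' x' y' z' : 0 <= a' + b' + c' -> a' <= 1 -> -1 <= c' ->
    0 <= x' -> x' <= y' -> y' <= z' -> 0 < x' + y' + z' ->
    0 < quartic a' b' c' x' y' z'.
  move=> s_ge0 a_le1 c_geN1 x_ge0 le_xy le_yz xyz_gt0.
  have := @quartic_sorted_gt0 a' b' c' x' (y' - x') (z' - y').
  by rewrite !subrKC => pos; apply: pos; lra.
move=> s_ge0 /andP[a_ge a_le] /andP[b_ge b_le] /andP[c_ge c_le].
move=> x_ge0 y_ge0 z_ge0 xyz_gt0.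
(* Adjacent transpositions sort the coordinates and carry the parameters along. The second and
   seventh cases are cyclic, hence contradictory. *)
case: (lerP x y) => xy; case: (lerP y z) => yz; case: (lerP x z) => xz.
- by apply: sorted; lra.
- by apply: sorted; lra.
- by rewrite quarticC23; apply: sorted; lra.
- by rewrite quarticC23 quarticC12; apply: sorted; lra.
- by rewrite quarticC12; apply: sorted; lra.
- by rewrite quarticC12 quarticC23; apply: sorted; lra.
- by lra.
- by rewrite quarticC12 quarticC23 quarticC12; apply: sorted; lra.
Qed.

End Quartic.

Lemma symmetric_tensor4_swap (R : Type) (n : nat) (T : tensor4 R n) :
  symmetric_tensor4 T -> forall i j k l,
  [/\ T i j k l = T j i k l, T i j k l = T i k j l & T i j k l = T i j l k].
Proof.
move=> Tsym i j k l; pose v (h : 'I_4) := nth i [:: i; j; k; l] h.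
split.
- by have := Tsym (tperm 0 1) v; rewrite !permE.
- by have := Tsym (tperm 1 2) v; rewrite !permE.
- by have := Tsym (tperm 2 3) v; rewrite !permE.
Qed.

Lemma tensor4_form_quartic (R : comPzRingType) (T : tensor4 R 3)
    (x : 'rV[R]_3) :
  symmetric_tensor4 T ->
  (forall i, T i i i i = 1) ->
  (forall i j, i != j -> T i i i j = 1) ->
  (forall i j, i != j -> T i i j j = -1) ->
  tensor4_form T x =
  quartic (T 0 0 1 2) (T 0 1 1 2) (T 0 1 2 2) (x 0 0) (x 0 1) (x 0 2).
Proof.
move=> Tsym Tdiag Tiiij Tiijj.
have sum3 (F : 'I_3 -> R) : \sum_i F i = F 0 + F 1 + F 2.
  rewrite !big_ord_recl big_ord0 addr0 addrA.
  by congr (F _ + F _ + F _); apply: val_inj.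
have C12 i j k l : T i j k l = T j i k l.
  by have [] := symmetric_tensor4_swap Tsym i j k l.
have C23 i j k l : T i j k l = T i k j l.
  by have [] := symmetric_tensor4_swap Tsym i j k l.
have C34 i j k l : T i j k l = T i j l k.
  by have [] := symmetric_tensor4_swap Tsym i j k l.
have Tijjj i j : i != j -> T i j j j = 1.
  by move=> ij; rewrite C12 C23 C34 Tiiij // eq_sym.
rewrite /tensor4_form !sum3.
(* Bubble sort on indices: each swap is instantiated only at a decreasing pair, so the repeated
   rewriting terminates with nondecreasing indices. *)
pose sort := (C12 1 0, C12 2 0, C12 2 1, fun i => C23 i 1 0,
  fun i => C23 i 2 0, fun i => C23 i 2 1, fun i j => C34 i j 1 0,
  fun i j => C34 i j 2 0, fun i j => C34 i j 2 1).
rewrite !sort !Tdiag.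
rewrite !(Tiiij 0 1, Tiiij 0 2, Tiiij 1 2) //.
rewrite !(Tijjj 0 1, Tijjj 0 2, Tijjj 1 2) //.
rewrite !(Tiijj 0 1, Tiijj 0 2, Tiijj 1 2) //.
by rewrite /quartic; ring.
Qed.

Theorem theorem3p3 (R : realType) (T : tensor4 R 3)
  (Tsym : symmetric_tensor4 T)
  (Tdiag : forall i : 'I_3, T i i i i = 1)
  (Tiiij : forall i j : 'I_3, i != j -> T i i i j = 1)
  (Tiijj : forall i j : 'I_3, i != j -> T i i j j = -1)
  (Tiijk : forall i j k : 'I_3, i != j -> i != k -> j != k ->
     T i i j k \in [:: -1; 0; 1]) :
  strictly_copositive4 T <-> 0 <= T 0 0 1 2 + T 0 1 1 2 + T 0 1 2 2.
Proof.
have TE x := tensor4_form_quartic x Tsym Tdiag Tiiij Tiijj.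
have Ta : T 0 0 1 2 \in [:: -1; 0; 1] by apply: Tiijk.
(* The sorted entries [0 1 1 2] and [0 1 2 2] are brought to the shape [iijk], as [1 1 0 2] and
   [2 2 0 1]. *)
have Tb : T 0 1 1 2 \in [:: -1; 0; 1].
  have [-> _ _] := symmetric_tensor4_swap Tsym 0 1 1 2.
  by have [_ -> _] := symmetric_tensor4_swap Tsym 1 0 1 2; apply: Tiijk.
have Tc : T 0 1 2 2 \in [:: -1; 0; 1].
  have [_ -> _] := symmetric_tensor4_swap Tsym 0 1 2 2.
  have [_ _ ->] := symmetric_tensor4_swap Tsym 0 2 1 2.
  have [-> _ _] := symmetric_tensor4_swap Tsym 0 2 2 1.
  by have [_ -> _] := symmetric_tensor4_swap Tsym 2 0 2 1; apply: Tiijk.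
split=> [Tpos | s_ge0 x x_neq0 x_ge0].
  have one_neq0 : const_mx 1 != 0 :> 'rV[R]_3.
    by apply/eqP => /matrixP/(_ 0 0)/eqP; rewrite !mxE oner_eq0.
  have : 0 < tensor4_form T (const_mx 1) by apply: Tpos => // i; rewrite mxE.
  rewrite TE !mxE /quartic !expr1n !mulr1.
  (* Positivity at the all-ones vector only gives a sum above [-3/4]; running through the 27
     possible triples uses integrality. *)
  move: Ta Tb Tc; rewrite !inE.
  by move=> /or3P[] /eqP-> /or3P[] /eqP-> /or3P[] /eqP->; lra.
have bound (t : R) : t \in [:: -1; 0; 1] -> -1 <= t <= 1.
  by rewrite !inE => /or3P[] /eqP->; lra.
rewrite TE; apply: quartic_gt0; rewrite ?bound //.
(* A zero sum of nonnegative coordinates would force [x = 0]. *)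
rewrite lt_neqAle !addr_ge0 // andbT eq_sym; apply: contra x_neq0.
rewrite !paddr_eq0 ?addr_ge0 // => /andP[/andP[/eqP x0 /eqP x1] /eqP x2].
apply/eqP/rowP => -[[|[|[|//]]] lt_i]; rewrite mxE.
- by rewrite -x0; congr (x 0 _); apply: val_inj.
- by rewrite -x1; congr (x 0 _); apply: val_inj.
- by rewrite -x2; congr (x 0 _); apply: val_inj.
Qed.
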